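(* There exists an absolute constant $k_0$ such that the following holds for all $k\ge k_0$ and $n\ge 64k^2$. Let $\mathcal F\subset\binom{[n]}{k}$ be a non-intersecting family with $|\mathcal F|\ge 4\Big(\binom{n-1}{k-1}-\binom{n-k-1}{k-1}+2\Big)$ and $d(\mathcal F)=d(|\mathcal F|,n,k)$. Then $$d(\mathcal F)\ge \frac{\frac{|\mathcal F|-\binom{n-2}{k-2}}{2}\binom{n-k-1}{k-1}}{\binom{n-2}{k-1}}-\binom{n-k-2}{k-2}\ \ge\ \frac12\Big(1-\frac{k^2}{n}\Big)|\mathcal F|-\frac32\binom{n-k-2}{k-2}.$$
   Context: $\binom{[n]}{k}$ is the family of $k$-subsets of $[n]$. A family is intersecting if any two of its members intersect. For $\mathcal F\subset\binom{[n]}{k}$, $d(\mathcal F)=\max_{F\in\mathcal F}|\{G\in\mathcal F:G\cap F=\emptyset\}|$. For a positive integer $m$, $d(m,n,k)=\min\{d(\mathcal F):\mathcal F\subset\binom{[n]}{k}, |\mathcal F|=m,\ \mathcal F\text{ not intersecting}\}$. *)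

(* Defs.v *)
From HB Require Import structures.
From mathcomp Require Import all_boot all_order all_algebra.

Set Implicit Arguments.
Unset Strict Implicit.
Unset Printing Implicit Defensive.

Definition ksubsets (n k : nat) : {set {set 'I_n}} :=
  [set A : {set 'I_n} | #|A| == k].

Definition intersecting (n : nat) (F : {set {set 'I_n}}) : bool :=
  [forall A in F, forall B in F, A :&: B != set0].

Definition dfam (n : nat) (F : {set {set 'I_n}}) : nat :=
  \max_(A in F) #|[set B in F | B :&: A == set0]|.

Definition admissible (m n k : nat) (F : {set {set 'I_n}}) : bool :=
  [&& F \subset ksubsets n k, #|F| == m & ~~ intersecting F].

(* The starting value 'C(n, k) is at least dfam F for every admissible F, so
   this is the true minimum as soon as some admissible family exists (see
   dminP); it is a junk value only when there is none. *)
Definition dmin (m n k : nat) : nat :=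
  \big[minn/'C(n, k)]_(F : {set {set 'I_n}} | admissible m k F) dfam F.

Lemma dfam_le_bin (n k : nat) (F : {set {set 'I_n}}) :
  F \subset ksubsets n k -> dfam F <= 'C(n, k).
Proof.
move=> sF; apply/bigmax_leqP => A _.
have <- : #|ksubsets n k| = 'C(n, k) by rewrite /ksubsets card_draws card_ord.
apply: subset_leq_card; apply: subset_trans sF.
by apply/subsetP => B; rewrite inE => /andP[].
Qed.

Lemma dminP (m n k : nat) (G : {set {set 'I_n}}) : admissible m k G ->
  (exists F : {set {set 'I_n}}, admissible m k F /\ dfam F = dmin m n k) /\
  (forall F : {set {set 'I_n}}, admissible m k F -> dmin m n k <= dfam F).
Proof.
move=> aG.
have lb (F : {set {set 'I_n}}) : admissible m k F -> dmin m n k <= dfam F.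
  move=> aF; rewrite /dmin; elim: index_enum (mem_index_enum F) => // H r IH.
  rewrite inE big_cons => /predU1P[<-|/IH le_r]; first by rewrite aF geq_minl.
  by case: ifP => // _; apply: leq_trans le_r; apply: geq_minr.
split=> //.
suff [E | //] : dmin m n k = 'C(n, k) \/
    exists F : {set {set 'I_n}}, admissible m k F /\ dfam F = dmin m n k.
  exists G; split=> //; apply/eqP; rewrite eqn_leq lb // andbT E.
  by apply: dfam_le_bin; case/and3P: aG.
rewrite /dmin.
elim/big_ind: _ => [|x y Hx Hy|F aF]; first by left.
- by case: (leqP x y).
- by right; exists F.
Qed.

(* Main.v *)
Require Import Defs.
From HB Require Import structures.
From mathcomp Require Import all_boot all_order all_algebra.
From mathcomp Require Import zify ring lra.
Import Order.TTheory GRing.Theory Num.Theory.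

Set Implicit Arguments.
Unset Strict Implicit.
Unset Printing Implicit Defensive.

(* Write m = |F|, c = C(n-2,k-2), and suppose d(F) is below the bound. Then every
   member of F meets more than half of F, so the degrees of its points add up
   to more than m/2. Members whose degree sum does not come from a few points
   of degree at least m/O(log k) are rare: such a member leads, greedily, to a
   set of j ~ log k points contained in a disproportionate share of them. As
   m >= 2kc, members containing two heavy points are rare too, so almost all of
   F is covered by at most two stars of density at least 3/8. With one star, a
   member off its centre is disjoint from too many others (Hilton-Milner count).
   With two stars, with centres x and y, the same greedy argument shows that at
   most c/4 members avoid both centres, and then the Hilton-Milner count rules
   those out altogether. Finally the members containing only x and those
   containing only y span a subgraph of the bipartite Kneser graph on the
   (k-1)-subsets of the other n-2 points. Its second eigenvalue is
   C(n-k-2,k-2), and the expander mixing lemma gives the bound. *)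

(** * Binomial estimates *)

Lemma leq_bin_add a M b :
  'C(M, b.+1) + a * 'C(M, b) <= 'C(M + a, b.+1).
Proof.
elim: a => [|a IH]; first by rewrite mul0n !addn0.
rewrite addnS binS mulSn; have := leq_bin2l b (leq_addr a M); lia.
Qed.

Lemma bin_add_leq a M b :
  'C(M + a, b.+1) <= 'C(M, b.+1) + a * 'C((M + a).-1, b).
Proof.
elim: a => [|a IH]; first by rewrite mul0n !addn0.
rewrite addnS binS mulSn /=.
have : a * 'C((M + a).-1, b) <= a * 'C(M + a, b).
  by rewrite leq_mul2l leq_bin2l ?orbT // leq_pred.
lia.
Qed.

(** Each of the [a] Pascal steps loses at most C(M + a - 1, b - 1), a fraction b / (M + a) of C(M +
    a, b). So C(M, b) / C(M + a, b) >= 1 - a b / (M + a), written without division. *)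
Lemma bin_ratio M a b :
  (M + a) * 'C(M + a, b) <= (M + a) * 'C(M, b) + a * b * 'C(M + a, b).
Proof.
case: b => [|b]; first by rewrite !bin0 leq_addr.
have := leq_mul (leqnn (M + a)) (bin_add_leq a M b).
rewrite mulnDr => /leq_trans; apply; rewrite leq_add2l.
by rewrite mulnCA mul_bin_diag mulnA.
Qed.

(** A step from (N, b) to (N - 1, b - 1) divides the binomial by N / b >= c, and [c * b <= N] passes
    to the smaller pair because c >= 1. *)
Lemma bin_decay c N b i : 0 < c -> c * b <= N -> i <= b ->
  c ^ i * 'C(N - i, b - i) <= 'C(N, b).
Proof.
move=> c0; elim: i N b => [|i IH] N b cb ib; first by rewrite mul1n !subn0.
case: b cb ib => // b cb ib; case: N cb => [|N] cb; first by nia.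
rewrite !subSS expnSr -mulnA (mulnC c) mulnA.
have : c ^ i * 'C(N - i, b - i) <= 'C(N, b) by apply: IH => //; nia.
rewrite -(leq_pmul2r c0) => /leq_trans; apply.
rewrite -(leq_pmul2l (ltn0Sn b)) -mul_bin_diag mulnCA mulnC.
by rewrite leq_mul2r mulnC cb orbT.
Qed.

(** The greedy argument prescribes [j] points: 2^j has to beat a multiple of k while j^2 stays below
    a small multiple of k. The choice j = floor(log2 k) + 8 does both, and it alone fixes the
    threshold k0. *)
Lemma log_scale : exists k0, forall k, k0 <= k ->
  exists j, [/\ 1 < j, 128 * k <= 2 ^ j & 8 * ((32 * j) ^ 2 + 1) <= k].
Proof.
(* Here [i + 30] stands for the logarithm of k and [i + 38] for [j]. *)
have bnd i : 8 * (32 * (i + 38) * (32 * (i + 38)) + 1) <= 2 ^ (i + 30).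
  elim: i => [|i].
    have -> : 0 + 30 = 10 + 10 + 10 by [].
    rewrite !expnD; have -> : 2 ^ 10 = 1024 by [].
    by lia.
  have -> : 2 ^ (i.+1 + 30) = 2 * 2 ^ (i + 30) by rewrite -expnS addSn.
  by move: (2 ^ (i + 30)) => P; nia.
exists (2 ^ 30) => k k0.
have kpos : 0 < k by apply: leq_trans k0; rewrite expn_gt0.
have /andP[lo hi] := trunc_log_bounds (isT : 1 < 2) kpos.
have L30 : 30 <= trunc_log 2 k by apply: trunc_log_max.
exists (trunc_log 2 k + 8); split; first by rewrite ltn_addl.
- by rewrite -addSnnS expnD mulnC leq_mul2r /= ltnW.
- apply: leq_trans lo; have := bnd (trunc_log 2 k - 30).
  rewrite subnK // -mulnn.
  by have -> : trunc_log 2 k - 30 + 38 = trunc_log 2 k + 8 by lia.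
Qed.

(** * Degrees and links *)

Section Families.
Variable T : finType.
Implicit Types (A B D E X : {set T}) (F : {set {set T}}) (x y : T).

Lemma card_between D B q : D \subset B ->
  #|[set A : {set T} | [&& D \subset A, A \subset B & #|A| == #|D| + q]]|
    = 'C(#|B| - #|D|, q).
Proof.
move=> DB.
have cB : #|B :\: D| = #|B| - #|D| by rewrite cardsD (setIidPr DB).
rewrite -cB -cards_draws -[RHS](card_in_imset (f := fun A => D :|: A)); last first.
  move=> A A'; rewrite !inE !subsetD.
  move=> /andP[/andP[_ dA] _] /andP[/andP[_ dA'] _] E.
  have H (C : {set T}) : [disjoint C & D] -> (D :|: C) :\: D = C.
    by move=> dC; rewrite setDUl setDv set0U; apply/setDidPl.
  by rewrite -(H A) // -(H A') // E.
apply: eq_card => A; rewrite !inE; apply/idP/imsetP.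
  case/and3P => DA AB /eqP cA; exists (A :\: D).
    by rewrite !inE setSD //= cardsD (setIidPr DA) cA addKn.
  by rewrite -{1}(setID A D) (setIidPr DA).
case=> C; rewrite !inE subsetD => /andP[/andP[CB dC] /eqP cC] ->.
rewrite subsetUl subUset DB CB cardsU cC disjoint_sym in dC *.
by rewrite (disjoint_setI0 dC) cards0 subn0 eqxx.
Qed.

Lemma card_supersets F k D : (forall A, A \in F -> #|A| = k) -> #|D| <= k ->
  #|[set A in F | D \subset A]| <= 'C(#|T| - #|D|, k - #|D|).
Proof.
move=> Fk Dk; rewrite -cardsT -card_between ?subsetT //.
apply/subset_leq_card/subsetP => A; rewrite !inE => /andP[/Fk -> ->].
by rewrite subsetT subnKC //= eqxx.
Qed.

Definition codeg F x y := #|[set A in F | (x \in A) && (y \in A)]|.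

Definition deg F x := #|[set A in F | x \in A]|.

Lemma codeg_leq F k x y : (forall A, A \in F -> #|A| = k) -> 1 < k -> x != y ->
  codeg F x y <= 'C(#|T| - 2, k - 2).
Proof.
move=> Fk k1 xy; have c2 : #|[set x; y]| = 2 by rewrite cards2 xy.
have := card_supersets (D := [set x; y]) Fk; rewrite c2 => /(_ k1).
by apply: leq_trans; apply/subset_leq_card/subsetP => A; rewrite !inE subUset !sub1set.
Qed.

(** The k-sets through x that avoid E lie between {x} and the complement of E. Together with the
    members counted on the left they form two disjoint families among all k-sets through x. *)
Lemma star_meeting F k x E : (forall A, A \in F -> #|A| = k) ->
  0 < k -> #|E| = k -> x \notin E ->
  #|[set A in F | (x \in A) && (A :&: E != set0)]| + 'C(#|T| - k - 1, k - 1)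
    <= 'C(#|T| - 1, k - 1).
Proof.
move=> Fk k0 Ek xE.
have := card_between (D := [set x]) (B := setT) (k - 1) (subsetT _).
rewrite cards1 cardsT => <-.
have := card_between (D := [set x]) (B := ~: E) (k - 1).
have -> : #|~: E| = #|T| - k by rewrite cardsCs setCK Ek.
rewrite cards1 => <-; last by rewrite sub1set inE.
rewrite -cardsUI [X in _ + X]eq_card0 ?addn0; last first.
  move=> A; rewrite !inE.
  apply/negP => /andP[/and3P[_ _ /set0Pn[y yE]] /and3P[_ /subsetP AE _]].
  by move: yE; rewrite inE => /andP[/AE]; rewrite inE => /negP.
apply/subset_leq_card/subsetP => A; rewrite !inE !sub1set subsetT subnKC //=.
by case/orP => [/and3P[/Fk -> -> _]|/and3P[-> _ ->]] //=.
Qed.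

Lemma sum_deg F X : \sum_(x in X) deg F x = \sum_(A in F) #|A :&: X|.
Proof.
rewrite /deg; under eq_bigr => x _ do rewrite -sum1dep_card.
rewrite (exchange_big_dep (mem F)) /=; last by move=> x A _ /andP[].
apply: eq_bigr => A AF; rewrite sum1dep_card; apply: eq_card => x.
by rewrite !inE AF /= andbC.
Qed.

(** The left side counts members with an ordered pair of distinct points of X inside; each of at
    most |X|^2 pairs lies in at most c members. *)
Lemma sum_pairs F X c : (forall x y, x != y -> codeg F x y <= c) ->
  \sum_(A in F) #|A :&: X| * #|A :&: X|.-1 <= #|X| ^ 2 * c.
Proof.
move=> Fc.
have -> : \sum_(A in F) #|A :&: X| * #|A :&: X|.-1 =
    \sum_(x in X) \sum_(y in X :\ x) codeg F x y.
  transitivity (\sum_(A in F) \sum_(x in X | x \in A) \sum_(y in X :\ x | y \in A) 1).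
    apply: eq_bigr => A _; rewrite -sum_nat_const; apply: eq_big => x.
      by rewrite inE andbC.
    rewrite inE => /andP[xA xX]; rewrite sum1dep_card.
    rewrite (cardsD1 x) inE xA xX /=; apply: eq_card => y.
    by rewrite !inE -!andbA; congr (_ && _); rewrite andbC.
  rewrite (exchange_big_dep (mem X)) /=; last by move=> A x _ /andP[].
  apply: eq_bigr => x xX.
  rewrite (exchange_big_dep (mem (X :\ x))) /=; last by move=> A y _ /andP[].
  apply: eq_bigr => y; rewrite !inE => /andP[yx yX].
  rewrite /codeg -sum1dep_card; apply: eq_bigl => A.
  by rewrite xX yX yx /= andbA.
apply: (@leq_trans (\sum_(x in X) #|X| * c)); last first.
  by rewrite sum_nat_const -mulnn mulnA.
apply: leq_sum => x xX.
apply: (@leq_trans (\sum_(y in X :\ x) c)).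
  by apply: leq_sum => y; rewrite !inE eq_sym => /andP[/Fc].
by rewrite sum_nat_const leq_mul2r subset_leq_card ?orbT ?subD1set.
Qed.

(** A truncated inclusion-exclusion, from a <= [a > 0] + a (a - 1) with a = |A :&: X|. *)
Lemma sum_deg_leq F X c : (forall x y, x != y -> codeg F x y <= c) ->
  \sum_(x in X) deg F x <= #|[set A in F | A :&: X != set0]| + #|X| ^ 2 * c.
Proof.
move=> Fc; rewrite sum_deg; apply: leq_trans (leq_add (leqnn _) (sum_pairs X Fc)).
rewrite -sum1dep_card big_mkcondr /= -big_split /=; apply: leq_sum => A _.
by rewrite -card_gt0; case: #|_| => // a /=; nia.
Qed.

Lemma two_hits_leq F X c : (forall x y, x != y -> codeg F x y <= c) ->
  #|[set A in F | 1 < #|A :&: X|]| <= #|X| ^ 2 * c.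
Proof.
move=> Fc; apply: leq_trans (sum_pairs X Fc).
rewrite -sum1dep_card big_mkcondr /=; apply: leq_sum => A _.
by case: #|_| => // a; case: a => //= a; nia.
Qed.

Lemma meeting_leq F E :
  #|[set A in F | A :&: E != set0]| <= \sum_(x in E) deg F x.
Proof.
rewrite sum_deg -sum1dep_card big_mkcondr /=; apply: leq_sum => A _.
by rewrite -card_gt0; case: #|_|.
Qed.

(* Pigeonhole, one point at a time: double counting shows that some point [x]
   outside [D] has a link at [x |: D] of size at least [t / W] times that at
   [D], and the links at sets of size [j] are at most [M]. *)
Lemma greedy_link (w : T -> nat) F j t W M : \sum_x w x <= W ->
  (forall A D, A \in F -> D \subset A -> #|D| < j ->
     t <= \sum_(x in A :\: D) w x) ->
  (forall D, #|D| = j -> #|[set A in F | D \subset A]| <= M) ->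
  #|F| * t ^ j <= W ^ j * M.
Proof.
move=> wW Ft FM.
(* Induction on the number of points still to be added: from sets of size [j], where [FM] applies,
   down to the empty set. *)
have IH i : i <= j -> forall D, #|D| = j - i ->
    #|[set A in F | D \subset A]| * t ^ i <= W ^ i * M.
  elim: i => [|i IH] ij D cD; first by rewrite muln1 mul1n FM // cD subn0.
  rewrite expnS mulnA.
  have : #|[set A in F | D \subset A]| * t <=
      \sum_(x in ~: D) w x * #|[set A in F | x |: D \subset A]|.
    rewrite -sum_nat_const.
    apply: (@leq_trans (\sum_(A in [set A in F | D \subset A]) \sum_(x in A :\: D) w x)).
      apply: leq_sum => A; rewrite inE => /andP[AF DA]; apply: Ft => //.
      by rewrite cD; lia.
    rewrite (exchange_big_dep (mem (~: D))) /=; last first.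
      by move=> A x _; rewrite !inE => /andP[].
    apply: leq_sum => x; rewrite inE => xD.
    rewrite sum_nat_const mulnC leq_mul2l; apply/orP; right.
    apply/subset_leq_card/subsetP => A; rewrite unfold_in !inE.
    case/andP=> /andP[-> DA] /andP[_ xA].
    by rewrite subUset sub1set xA.
  move=> h.
  apply: leq_trans (leq_mul h (leqnn (t ^ i))) _; rewrite big_distrl /=.
  apply: (@leq_trans (\sum_(x in ~: D) w x * (W ^ i * M))).
    apply: leq_sum => x; rewrite inE => xD; rewrite -mulnA leq_mul2l.
    by rewrite IH ?orbT ?cardsU1 ?xD ?cD; lia.
  rewrite -big_distrl /= [W ^ i.+1]expnS -[W * _ * M]mulnA leq_mul2r; apply/orP; right.
  apply: leq_trans wW; rewrite [X in _ <= X](bigID (mem (~: D))) /=; exact: leq_addr.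
have := IH j (leqnn _) set0; rewrite subnn cards0 => /(_ erefl).
by congr (_ * _ <= _); apply: eq_card => A; rewrite !inE sub0set andbT.
Qed.

End Families.

(** * Concentration on points of high degree *)

Section Concentration.
Variable T : finType.
Implicit Types (A B D E X : {set T}) (F : {set {set T}}) (x y : T).

(* Since [64 * k * (k - 2) <= #|T| - 2], each of the [j - 2] further points
   prescribed in [greedy_link] costs a factor [64 * k] while it gains only
   [16 * k], and [4 ^ j] beats any fixed power of [k]. *)
Lemma heavy_members_few (w : T -> nat) F j k m :
  (forall A, A \in F -> #|A| = k) -> 1 < j -> j <= k -> 64 * k ^ 2 <= #|T| ->
  128 * k <= 2 ^ j -> 0 < m -> \sum_x w x <= k * m ->
  (forall A D, A \in F -> D \subset A -> #|D| < j ->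
     m <= 16 * \sum_(x in A :\: D) w x) ->
  4 * #|F| <= 'C(#|T| - 2, k - 2).
Proof.
move=> Fk j1 jk nk kj m0 wm Fw.
have link : #|F| * m ^ j <= (16 * (k * m)) ^ j * 'C(#|T| - j, k - j).
  apply: (@greedy_link T (fun x => 16 * w x)).
  - by rewrite -big_distrr leq_mul2l.
  - move=> A D AF DA Dj; rewrite -big_distrr /=; exact: Fw.
  - by move=> D cD; rewrite -cD; apply: card_supersets; rewrite ?cD.
have {}link : #|F| <= (16 * k) ^ j * 'C(#|T| - j, k - j).
  rewrite -(leq_pmul2r (_ : 0 < m ^ j)) ?expn_gt0 ?m0 //.
  by apply: leq_trans link _; rewrite mulnA expnMn mulnAC.
have decay : (64 * k) ^ (j - 2) * 'C(#|T| - j, k - j) <= 'C(#|T| - 2, k - 2).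
  have := @bin_decay (64 * k) (#|T| - 2) (k - 2) (j - 2).
  by rewrite -!subnDA !subnKC //; move: nk; rewrite -mulnn; nia.
have : #|F| * 4 ^ (j - 2) <= (16 * k) ^ 2 * 'C(#|T| - 2, k - 2).
  apply: leq_trans (leq_mul link (leqnn _)) _.
  have -> : (16 * k) ^ j * 'C(#|T| - j, k - j) * 4 ^ (j - 2) =
      (16 * k) ^ 2 * ((64 * k) ^ (j - 2) * 'C(#|T| - j, k - j)).
    rewrite (_ : 64 * k = 16 * k * 4); last by lia.
    rewrite -{1}(subnKC j1) expnD (expnMn (16 * k)) -!mulnA.
    by congr (_ * (_ * (_ * (_ * (_ * _))))); rewrite mulnC.
  by rewrite leq_mul2l decay orbT.
(* Hence 4^(j - 2) >= 1024 k^2, four times the factor (16 k)^2 on the other side. *)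
have : (128 * k) * (128 * k) <= 16 * 4 ^ (j - 2).
  have -> : 16 * 4 ^ (j - 2) = 2 ^ j * 2 ^ j.
    by rewrite -{2 3}(subnKC j1) !expnD -[4 in LHS]/(2 * 2) expnMn; lia.
  exact: leq_mul.
rewrite -mulnn; move: (4 ^ _) ('C(_, _)) => P c hP hc.
have k0 : 0 < k * k by nia.
rewrite -(leq_pmul2r k0); nia.
Qed.

(** * Reduction to two stars *)

Section Structure.
Variables (F : {set {set T}}) (j k : nat).
Let m := #|F|.
Let c := 'C(#|T| - 2, k - 2).
(** The Hilton-Milner count: k-sets through a point that meet a given k-set avoiding that point. *)
Let h := 'C(#|T| - 1, k - 1) - 'C(#|T| - k - 1, k - 1).
Hypothesis Fk : forall A, A \in F -> #|A| = k.
Hypothesis j1 : 1 < j.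
Hypothesis kj : 128 * k <= 2 ^ j.
Hypothesis jk : 8 * ((32 * j) ^ 2 + 1) <= k.
Hypothesis nk : 64 * k ^ 2 <= #|T|.
Hypothesis m_c : 2 * k * c <= m.
Hypothesis m_h : 4 * (h + 2) <= m.
(** In this section, failure of the claimed bound enters through this inequality. *)
Hypothesis few_disjoint :
  forall A, A \in F -> 2 * #|[set B in F | B :&: A == set0]| + c < m.

Let m0 : 0 < m. Proof. by lia. Qed.

Let k_j : 1000 * j <= k.
Proof. by move: jk j1; rewrite -mulnn; clear; nia. Qed.

Let m_sq : 16 * ((32 * j) ^ 2 * c + c) <= m.
Proof.
apply: leq_trans m_c; rewrite -mulSnr -addn1 mulnA leq_mul2r.
by apply/orP; right; move: jk; lia.
Qed.

Let m_j : 4000 * j * c <= m.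
Proof.
apply: leq_trans m_sq; rewrite mulnDr -!mulnn mulnA.
apply: leq_trans (leq_addr _ _); rewrite leq_mul2r.
by apply/orP; right; move: j1; clear; nia.
Qed.

Let m_1 : 1000 * c <= m.
Proof. by apply: leq_trans m_j; rewrite leq_mul2r; apply/orP; right; lia. Qed.

Let codegF x y : x != y -> codeg F x y <= c.
Proof. by apply: codeg_leq => //; lia. Qed.

Let disjoint_meeting A :
  #|[set B in F | B :&: A == set0]| + #|[set B in F | B :&: A != set0]| = m.
Proof.
rewrite /m -(cardsID [set B : {set T} | B :&: A == set0] F).
by congr (_ + _); apply: eq_card => B; rewrite !inE // andbC.
Qed.

Let meeting A : A \in F -> m + c < 2 * #|[set B in F | B :&: A != set0]|.
Proof. by move=> /few_disjoint; have := disjoint_meeting A; lia. Qed.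

Let sum_degF : \sum_x deg F x <= k * m.
Proof.
have -> : \sum_x deg F x = \sum_(x in [set: T]) deg F x.
  by apply: eq_bigl => x; rewrite inE.
rewrite sum_deg mulnC /m -sum_nat_const; apply: leq_sum => A /Fk <-.
by rewrite subset_leq_card ?subsetIl.
Qed.

Let H := [set x | m <= 16 * j * deg F x].

(** The degrees of 32 j points of [H] would add up to at least 2 m, whereas [sum_deg_leq] allows
    only m + (32 j)^2 c, which is at most 17 m / 16. *)
Let card_H : #|H| < 32 * j.
Proof.
rewrite ltnNge; apply/negP => jH.
have /set0Pn[X] : [set X : {set T} | X \subset H & #|X| == 32 * j] != set0.
  by rewrite -card_gt0 cards_draws bin_gt0.
rewrite inE => /andP[XH /eqP cX].
have := sum_deg_leq X codegF; rewrite cX.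
have le_m : #|[set A in F | A :&: X != set0]| <= m.
  by apply/subset_leq_card/subsetP => A; rewrite inE => /andP[].
have : \sum_(x in X) m <= \sum_(x in X) 16 * j * deg F x.
  by apply: leq_sum => x /(subsetP XH); rewrite inE.
rewrite sum_nat_const cX -big_distrr /= => h1 h2.
have h3 : 2 * m <= \sum_(x in X) deg F x.
  by move: h1 j1; move: (\sum_(x in X) _) m => s m1; clear; nia.
move: h2 h3 le_m m_sq m0; move: (_ ^ 2 * c) (\sum_(x in X) _) #|_| => Q s a.
by move: m c => m1 c1; clear; lia.
Qed.

Let light := [set A in F | m <= 8 * \sum_(x in A :\: H) deg F x].

(** The weight is the degree, set to 0 on [H]. Fewer than j prescribed points carry weight at most m
    / 16 in total, so of the m / 8 in a member of [light] at least m / 16 always remains. *)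
Let card_light : 4 * #|light| <= c.
Proof.
pose w x := if x \in H then 0 else deg F x.
have wE A : \sum_(x in A) w x = \sum_(x in A :\: H) deg F x.
  rewrite (bigID (mem H)) /= big1 ?add0n => [|x /andP[_ xH]]; last by rewrite /w xH.
  apply: eq_big => x; first by rewrite in_setD andbC.
  by move=> /andP[_]; rewrite /w inE => /negbTE ->.
apply: (@heavy_members_few w light j k m) => //; rewrite ?/light.
- by move=> A; rewrite inE => /andP[/Fk].
- by lia.
- by apply: leq_trans sum_degF; apply: leq_sum => x _; rewrite /w; case: ifP.
move=> A D; rewrite inE => /andP[AF mA] DA Dj.
have : \sum_(x in D) w x * (16 * j) <= \sum_(x in D) m.
  apply: leq_sum => x _; rewrite /w; case: ifP => //; rewrite inE => /negbT.
  by rewrite -ltnNge; nia.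
rewrite sum_nat_const -big_distrl /= => hD.
have E : \sum_(x in A) w x = \sum_(x in D) w x + \sum_(x in A :\: D) w x.
  by rewrite (big_setID D) /= (setIidPr DA).
rewrite -wE E in mA.
have : 16 * \sum_(x in D) w x <= m.
  by move: hD Dj; move: (\sum_(x in D) _) #|_| m => s d m1; clear; nia.
by lia.
Qed.

Let G := [set x | 3 * m <= 8 * deg F x].

(** A member has degree sum above m / 2. If it is not in [light] and has at most one point in [H],
    less than m / 8 comes from outside [H], so that one point exists and has degree above 3 m / 8.
    The exceptions number at most c / 4 + (32 j)^2 c. *)
Let missG : 16 * #|[set A in F | A :&: G == set0]| <= m.
Proof.
have sub : [set A in F | A :&: G == set0] \subset
    light :|: [set A in F | 1 < #|A :&: H|].
  apply/subsetP => A; rewrite inE => /andP[AF AG]; apply: contraT.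
  rewrite !in_setU !in_set AF /= negb_or -ltnNge -leqNgt => /andP[lA hA].
  have := meeting AF; have := meeting_leq F A.
  rewrite (big_setID H) /=.
  have [H0|[x xAH]] := set_0Vmem (A :&: H).
    by rewrite H0 big_set0; lia.
  have E : A :&: H = [set x].
    by apply/eqP; rewrite eq_sym eqEcard sub1set xAH cards1.
  rewrite E big_set1 => h1 h2.
  have : x \in A :&: G.
    by move: xAH; rewrite !inE => /andP[-> _] /=; lia.
  by rewrite (eqP AG) inE.
have := subset_leq_card sub; have := (leq_card_setU light [set A in F | 1 < #|A :&: H|]).1.
have := two_hits_leq H codegF.
have : #|H| ^ 2 * c <= (32 * j) ^ 2 * c by rewrite leq_mul2r leq_exp2r // ltnW ?orbT.
by move: card_light m_sq; move: (_ ^ 2 * c) (_ ^ 2 * c) => Q Q'; lia.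
Qed.

(** Three points of [G] would give 9 m / 8 <= m + 9 c, contrary to m >= 1000 c. *)
Let card_G : #|G| <= 2.
Proof.
rewrite leqNgt; apply/negP => G3.
have /set0Pn[X] : [set X : {set T} | X \subset G & #|X| == 3] != set0.
  by rewrite -card_gt0 cards_draws bin_gt0.
rewrite inE => /andP[XG /eqP cX].
have := sum_deg_leq X codegF; rewrite cX.
have le_m : #|[set A in F | A :&: X != set0]| <= m.
  by apply/subset_leq_card/subsetP => A; rewrite inE => /andP[].
have : \sum_(x in X) 3 * m <= \sum_(x in X) 8 * deg F x.
  by apply: leq_sum => x /(subsetP XG); rewrite inE.
rewrite sum_nat_const cX -big_distrr /=.
move: le_m m_1 m0; rewrite -[3 ^ 2]/9.
by move: (\sum_(x in X) _) #|_| m c => s a m1 c1; clear; lia.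
Qed.

Let starh x E : E \in F -> x \notin E ->
  #|[set A in F | (x \in A) && (A :&: E != set0)]| <= h.
Proof.
move=> EF xE; have k0 : 0 < k by lia.
by have := star_meeting Fk k0 (Fk EF) xE; rewrite /h; lia.
Qed.

Lemma two_centers : (exists A B, [/\ A \in F, B \in F & A :&: B = set0]) ->
  exists x y, [/\ x != y, 3 * m <= 8 * deg F x, 3 * m <= 8 * deg F y &
    forall A, A \in F -> (x \in A) || (y \in A)].
Proof.
case=> A0 [B0 [A0F B0F AB0]].
have missE E X : #|[set A in F | A :&: E != set0]| <=
   #|[set A in F | A :&: X == set0]| +
   \sum_(x in X) #|[set A in F | (x \in A) && (A :&: E != set0)]|.
  apply: leq_trans (_ : #|[set A in F | A :&: X == set0]| +
     #|[set A in [set A in F | A :&: E != set0] | A :&: X != set0]| <= _).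
    apply: leq_trans (leq_card_setU _ _).1.
    apply/subset_leq_card/subsetP => A; rewrite !inE => /andP[-> ->].
    by rewrite /= orbN.
  rewrite leq_add2l; apply: leq_trans (meeting_leq _ _) _.
  rewrite leq_eqVlt; apply/orP; left; apply/eqP; apply: eq_bigr => x _.
  by apply: eq_card => A; rewrite !inE -andbA [(x \in A) && _]andbC.
have [GE|[x xG]] := set_0Vmem G.
  move: missG; rewrite GE.
  have -> : [set A in F | A :&: set0 == set0] = F.
    by apply/setP => A; rewrite !inE setI0 eqxx andbT.
  by rewrite -/m; lia.
(* With a single centre x, a member B off x meets at most m / 16 + h members, which is less than m /
   2 since h < m / 4. *)
have [G1|[y]] := set_0Vmem (G :\ x).
  have GE : G = [set x] by rewrite -(setD1K xG) G1 setU0.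
  have [B BF xB] : exists2 B, B \in F & x \notin B.
    case: (boolP (x \in A0)) => xA; last by exists A0.
    exists B0 => //; apply/negP => xB.
    by have := in_set0 x; rewrite -AB0 inE xA xB.
  have := missE B G; have := missG; rewrite GE big_set1.
  by have := starh BF xB; have := meeting BF; lia.
rewrite !inE => /andP[yx yG].
have GE : G = [set x; y].
  apply/eqP; rewrite eq_sym eqEcard cards2 eq_sym yx card_G andbT.
  by rewrite subUset !sub1set xG inE yG.
exists x, y; split; rewrite 1?eq_sym //; first by move: xG; rewrite inE.
pose S := [set A in F | A :&: G == set0].
have missS A : A \in S -> (x \notin A) && (y \notin A).
  rewrite inE => /andP[_ /eqP AG].
  by apply/andP; split; apply/negP => zA; [have := in_set0 x | have := in_set0 y];
     rewrite -AG in_setI zA ?xG // inE yG.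
have [S0|[E ES]] := set_0Vmem S.
  move=> A AF; apply/norP => -[xA yA].
  suff : A \in S by rewrite S0 inE.
  rewrite inE AF GE /=; apply/eqP/setP => z; rewrite !inE.
  case: eqVneq => [->|_]; first by rewrite (negbTE xA).
  by case: eqVneq => [->|_]; rewrite ?(negbTE yA) ?andbF.
exfalso.
have EF : E \in F by move: ES; rewrite inE => /andP[].
(* Members outside [S] contain x or y, so any other point has degree at most 2 c among them, and
   fewer than j prescribed points are negligible. A member of [S] still meets more than m / 2 - m /
   16 members outside [S]. *)
have cS : 4 * #|S| <= c.
  apply: (@heavy_members_few (deg (F :\: S)) S j k m) => //.
  - by move=> A; rewrite inE => /andP[/Fk].
  - by lia.
  - apply: leq_trans sum_degF; apply: leq_sum => z _.
    by apply/subset_leq_card/subsetP => A; rewrite !inE => /andP[/andP[_ ->]].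
  move=> A D AS DA Dj.
  have AF : A \in F by move: AS; rewrite inE => /andP[].
  have /andP[xA yA] := missS A AS.
  have hD : \sum_(z in D) deg (F :\: S) z <= #|D| * (2 * c).
    rewrite -sum_nat_const; apply: leq_sum => z zD.
    have zx : z != x by apply: contraNneq xA => <-; apply: (subsetP DA).
    have zy : z != y by apply: contraNneq yA => <-; apply: (subsetP DA).
    have := leq_add (codegF zx) (codegF zy); rewrite addnn -mul2n.
    apply: leq_trans; apply: leq_trans (leq_card_setU _ _).1.
    apply/subset_leq_card/subsetP => B; rewrite !inE => /andP[/andP[BS BF] zB].
    move: BS; rewrite BF zB /= => /set0Pn[u]; rewrite GE !inE => /andP[uB].
    by case/orP => /eqP <-; rewrite uB ?orbT.
  have := meeting AF; have := meeting_leq (F :\: S) A.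
  rewrite [X in _ <= X -> _](big_setID D) /= (setIidPr DA).
  have : #|[set B in F | B :&: A != set0]| <= #|S| + #|[set B in F :\: S | B :&: A != set0]|.
    apply: leq_trans (leq_card_setU _ _).1.
    by apply/subset_leq_card/subsetP => B; rewrite !inE => /andP[-> ->]; rewrite !andbT orbN.
  have := missG; rewrite -/S.
  have : #|D| * (2 * c) * 1000 <= m.
    by move: m_j Dj; move: #|D| c m => d c1 m1; clear; nia.
  move: hD; move: (#|D| * _) (\sum_(x in D) _) (\sum_(x in A :\: D) _) => p q r.
  by move: #|_| #|_| #|_| m c => s u v m1 c1; clear; lia.
(* A member E of [S] meets at most c / 4 + 2 h <= c / 4 + m / 2 members, but more than (m + c) / 2
   by [meeting]: the slack c absorbs [S]. *)
have := missE E G; rewrite GE big_setU1 ?inE 1?eq_sym // big_set1.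
have /andP[xE yE] := missS E ES.
have := starh EF xE; have := starh EF yE; have := meeting EF; rewrite -GE -/S.
by move: cS m_h => /=; move: #|_| #|_| #|_| #|_| m c h => s u v t m1 c1 h1; clear; lia.
Qed.

End Structure.
End Concentration.

Local Open Scope ring_scope.

(** * The spectral gap of Kneser graphs *)

Section Spectral.
Variables (T : finType) (V : {set T}) (R : realFieldType).
Implicit Types (f g : {set T} -> R) (S : {set T}) (i j q : nat).

Definition level j : {set {set T}} :=
  [set S : {set T} | (S \subset V) && (#|S| == j)].

Definition dot j f g : R := \sum_(S in level j) f S * g S.

(** Functions live on all sets, but [down] is read as a map from level j + 1 to level j, and [up] as
    its adjoint. *)
Definition down f S : R := \sum_(x in V :\: S) f (x |: S).

Definition up f S : R := \sum_(x in S) f (S :\ x).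

(** Both sides sum over the sets of level j + 1 with a point to remove. *)
Lemma dot_down j f g : dot j (down f) g = dot j.+1 f (up g).
Proof.
rewrite /dot /down /up.
under eq_bigr => S _ do rewrite mulr_suml.
under [RHS]eq_bigr => S _ do rewrite mulr_sumr.
rewrite !pair_big_dep /=.
rewrite (reindex_onto (fun p : {set T} * T => (p.1 :\ p.2, p.2))
   (fun p : {set T} * T => (p.2 |: p.1, p.2))) /=.
  apply: eq_big => [[S x]|[S x]] /=.
    rewrite !inE eqxx /= xpair_eqE eqxx andbT.
    apply/idP/idP => [/andP[/andP[/andP[sV cS] xV] /eqP E]|].
      have xS : x \in S by rewrite -E !inE eqxx.
      rewrite xS andbT -{1}E subUset sub1set xV sV /=.
      by rewrite (cardsD1 x) xS add1n eqSS.
    case/andP => /andP[sV cS] xS.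
    rewrite (subset_trans (subsetDl _ _) sV) (subsetP sV _ xS) setD1K // eqxx.
    by rewrite (cardsD1 x) xS add1n eqSS in cS; rewrite cS.
  by case/andP=> _ /eqP[->].
case=> S x /=; rewrite !inE => /andP[_ /andP[xS xV]].
by rewrite setU1K.
Qed.

(** Exchanging a point of S for one outside gives the same terms in either order. Only the diagonal
    differs: |V| - |S| returns to S against |S|. *)
Lemma down_up f S : S \subset V ->
  down (up f) S = up (down f) S + (#|V|%:R - 2 * #|S|%:R) * f S.
Proof.
move=> sV; rewrite /down /up.
have -> : \sum_(x in V :\: S) \sum_(y in x |: S) f ((x |: S) :\ y) =
  \sum_(x in V :\: S) (f S + \sum_(y in S) f (x |: (S :\ y))).
  apply: eq_bigr => x; rewrite inE => /andP[xS xV].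
  rewrite big_setU1 //= setU1K //; congr (_ + _).
  apply: eq_bigr => y yS; congr f; apply/setP => z; rewrite !inE.
  by case: (eqVneq z x) => [->|//]; case: (eqVneq x y) yS xS => [->->|].
have -> : \sum_(x in S) \sum_(y in V :\: (S :\ x)) f (y |: (S :\ x)) =
  \sum_(x in S) (f S + \sum_(y in V :\: S) f (y |: (S :\ x))).
  apply: eq_bigr => x xS.
  have -> : V :\: (S :\ x) = x |: (V :\: S).
    apply/setP => z; rewrite !inE; case: (eqVneq z x) => [->|//].
    by rewrite (subsetP sV).
  by rewrite big_setU1 ?inE ?xS //= setD1K.
rewrite !big_split /= !sumr_const exchange_big /= -![f S *+ _]mulr_natl.
have -> : #|V :\: S|%:R = #|V|%:R - #|S|%:R :> R.
  by rewrite cardsD (setIidPr sV) natrB // subset_leq_card.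
ring.
Qed.

Lemma sum_down j f :
  \sum_(S in level j) down f S = j.+1%:R * \sum_(S in level j.+1) f S.
Proof.
have := dot_down j f (fun=> 1); rewrite /dot.
under eq_bigr => S _ do rewrite mulr1.
move=> ->; rewrite mulr_sumr; apply: eq_bigr => S; rewrite inE => /andP[_ /eqP cS].
by rewrite /up sumr_const cS mulrC.
Qed.

Lemma dot_ge0 j f : 0 <= dot j f f.
Proof. by apply: sumr_ge0 => S _; rewrite -expr2 sqr_ge0. Qed.

Lemma dotC j f g : dot j f g = dot j g f.
Proof. by apply: eq_bigr => S _; rewrite mulrC. Qed.

Lemma cauchy_schwarz j f g : dot j f g ^+ 2 <= dot j f f * dot j g g.
Proof.
have [g0|gn0] := eqVneq (dot j g g) 0.
  suff -> : dot j f g = 0 by rewrite expr0n /= g0 mulr0.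
  apply: big1 => S lS; suff -> : g S = 0 by rewrite mulr0.
  apply/eqP; rewrite -sqrf_eq0 expr2; apply/eqP.
  by have /psumr_eq0P := g0; apply=> // U _; rewrite -expr2 sqr_ge0.
have c0 : 0 < dot j g g by rewrite lt0r gn0 dot_ge0.
have sqE (u v : R) : \sum_(S in level j) (u * f S - v * g S) ^+ 2 =
    u ^+ 2 * dot j f f - 2 * u * v * dot j f g + v ^+ 2 * dot j g g.
  rewrite /dot !mulr_sumr -sumrB -big_split /=.
  by apply: eq_bigr => S _; ring.
have : 0 <= \sum_(S in level j) (dot j g g * f S - dot j f g * g S) ^+ 2.
  by apply: sumr_ge0 => S _; rewrite sqr_ge0.
rewrite sqE => h; rewrite -subr_ge0 -(pmulr_rge0 _ c0).
apply: le_trans h _; rewrite le_eqVlt.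
by apply/orP; left; apply/eqP; ring.
Qed.

(* The factor [j * (#|V| - j - 1)] is the second largest eigenvalue of [up] after
   [down]. The induction works because [up] and [down] are adjoint, so that
   [down_up] turns the bound for [down] on one level into one for [up], which
   has the same norm as [down] from the next level. *)
Lemma down_contract j f : (j < #|V|)%N -> \sum_(S in level j.+1) f S = 0 ->
  dot j (down f) (down f) <= j%:R * (#|V|%:R - j.+1%:R) * dot j.+1 f f.
Proof.
elim: j f => [|j IH] f jV f0.
  have := sum_down 0 f; rewrite f0 mulr0 mul0r mul0r.
  have -> : level 0 = [set set0].
    apply/setP => S; rewrite !inE cards_eq0.
    by case: eqP => [->|]; rewrite ?sub0set ?andbF.
  rewrite big_set1 /dot => E.
  by rewrite big1 // => S; rewrite inE cards_eq0 => /andP[_ /eqP ->]; rewrite E mulr0.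
set g := down f; pose mu : R := j.+1%:R * (#|V|%:R - j.+2%:R).
rewrite -[X in _ <= X]/(mu * _).
have g0 : \sum_(S in level j.+1) g S = 0 by rewrite sum_down f0 mulr0.
have gg : dot j.+1 g g = dot j.+2 f (up g) by rewrite dot_down.
(* The eigenvalue recursion: j (|V| - j - 1) + |V| - 2 (j + 1) = (j + 1) (|V| - j - 2). *)
have ug : dot j.+2 (up g) (up g) <= mu * dot j.+1 g g.
  rewrite -dot_down.
  have -> : dot j.+1 (down (up g)) g =
      dot j.+1 (up (down g)) g + (#|V|%:R - 2 * j.+1%:R) * dot j.+1 g g.
    rewrite /dot mulr_sumr -big_split; apply: eq_bigr => S.
    by rewrite inE => /andP[sV /eqP cS]; rewrite down_up // cS /=; ring.
  rewrite dotC -dot_down.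
  apply: le_trans (lerD (IH g (ltnW jV) g0) (lexx _)) _.
  by rewrite -mulrDl /mu le_eqVlt; apply/orP; left; apply/eqP; ring.
have [gz|gn0] := eqVneq (dot j.+1 g g) 0.
  rewrite gz mulr_ge0 ?dot_ge0 // mulr_ge0 // subr_ge0 ler_nat //.
have gp : 0 < dot j.+1 g g by rewrite lt0r gn0 dot_ge0.
(* By Cauchy-Schwarz the square of <g, g> = <f, up g> is at most <f, f> mu <g, g>; one factor <g, g>
   cancels. *)
rewrite -(ler_pM2l gp) -expr2 {1}gg.
apply: le_trans (cauchy_schwarz _ _ _) _.
apply: le_trans (ler_wpM2l (dot_ge0 _ _) ug) _.
by rewrite le_eqVlt; apply/orP; left; apply/eqP; ring.
Qed.

Lemma iter_down_contract i q f : (i + q <= #|V|)%N ->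
  \sum_(S in level (i + q)) f S = 0 ->
  dot i (iter q down f) (iter q down f) <=
  (\prod_(l < q) ((i + l) * (#|V| - (i + l).+1)))%:R * dot (i + q) f f.
Proof.
elim: q f => [|q IH] f iV f0; first by rewrite big_ord0 mul1r addn0.
rewrite addnS in iV f0 *.
rewrite !iterSr big_ord_recr /=.
apply: le_trans (IH (down f) (ltnW iV) _) _.
  by rewrite sum_down f0 mulr0.
rewrite [X in _ <= X * _]natrM -mulrA ler_wpM2l // natrM natrB //.
exact: down_contract.
Qed.

(** The q extra points of a superset can be added in q! orders. *)
Lemma iter_downE q f S : S \subset V ->
  iter q down f S = q`!%:R * \sum_(U in level (#|S| + q) | S \subset U) f U.
Proof.
elim: q S => [|q IH] S sV.
  rewrite mul1r (big_pred1 S) // => U; rewrite !inE addn0.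
  apply/idP/eqP => [/andP[/andP[UV cU] SU]|->]; last by rewrite sV eqxx subxx.
  by apply/esym/eqP; rewrite eqEcard SU (eqP cU) leqnn.
rewrite /= {1}/down.
have -> : \sum_(x in V :\: S) iter q down f (x |: S) =
  \sum_(x in V :\: S) \sum_(U in level (#|S| + q.+1) | x |: S \subset U) q`!%:R * f U.
  apply: eq_bigr => x; rewrite inE => /andP[xS xV].
  rewrite IH ?subUset ?sub1set ?xV // mulr_sumr.
  by rewrite cardsU1 xS add1n addSnnS.
rewrite (exchange_big_dep
  (fun U => (U \in level (#|S| + q.+1)) && (S \subset U))) /=; last first.
  by move=> x U _ /andP[->]; rewrite subUset => /andP[].
rewrite mulr_sumr; apply: eq_bigr => U /andP[lU SU].
have := lU; rewrite inE => /andP[UV /eqP cU].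
rewrite (eq_bigl (fun x => x \in U :\: S)); last first.
  move=> x; rewrite !inE subUset sub1set SU UV cU eqxx /= andbT.
  by case xU: (x \in U); rewrite ?andbF // (subsetP UV) // !andbT.
rewrite sumr_const cardsD (setIidPr SU) cU addKn factS natrM -[_ *+ q.+1]mulr_natl; ring.
Qed.

(** Reversing the index shows that both factors have the same product (i + q)! / i!, so the whole is
    a square. *)
Lemma prod_contract i q N : N = (i.+1 + i.+1 + q)%N ->
  (\prod_(l < q) ((i.+1 + l) * (N - (i.+1 + l).+1)) =
   (q`! * 'C(N - i.+2, i)) ^ 2)%N.
Proof.
move=> ->; rewrite big_split /=.
have -> : (\prod_(l < q) (i.+1 + i.+1 + q - (i.+1 + l).+1) =
           \prod_(l < q) (i.+1 + l))%N.
  rewrite (reindex_inj rev_ord_inj) /=; apply: eq_bigr => l _.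
  by have := ltn_ord l; lia.
suff -> : (\prod_(l < q) (i.+1 + l) = q`! * 'C(i.+1 + i.+1 + q - i.+2, i))%N.
  by rewrite expnS expn1.
have -> : (i.+1 + i.+1 + q - i.+2 = i + q)%N by lia.
have -> : 'C(i + q, i) = 'C(i + q, q) by rewrite -bin_sub ?leq_addr // addKn.
rewrite mulnC bin_ffact ffact_prod (reindex_inj rev_ord_inj) /=.
by apply: eq_bigr => l _; have := ltn_ord l; lia.
Qed.

(* A set is disjoint from [S] when it lies below the complement of [S], so the
   Kneser operator is, up to a factorial, an iterate of [down]; the product of
   the one-step norms is exactly the second eigenvalue of the Kneser graph. *)
Lemma kneser_bound K f g : (0 < K)%N -> (K + K <= #|V|)%N ->
  \sum_(S in level K) f S = 0 ->
  (\sum_(S in level K) \sum_(U in level K | [disjoint S & U]) f S * g U) ^+ 2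
    <= 'C(#|V| - K.+1, K.-1)%:R ^+ 2 * dot K f f * dot K g g.
Proof.
case: K => // K _ KV f0; rewrite /=.
set q := (#|V| - (K.+1 + K.+1))%N.
have Vq : #|V| = (K.+1 + K.+1 + q)%N by rewrite subnKC.
(* Complementation turns the sets disjoint from U into the supersets of U on level [K.+1 + q]. *)
pose h U := f (V :\: U).
have lev (F : {set T} -> R) :
    \sum_(S in level (K.+1 + q)) F (V :\: S) = \sum_(S in level K.+1) F S.
  rewrite [RHS](reindex_onto (fun S => V :\: S) (fun S => V :\: S)) /=.
    apply: eq_big => // S; rewrite !inE subsetDl /= setDDr setDv set0U.
    case SV: (S \subset V) => /=.
      rewrite (setIidPr SV) eqxx andbT cardsD (setIidPr SV) Vq.
      by have := subset_leq_card SV; rewrite Vq => ?; apply/eqP/eqP; lia.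
    by rewrite (sameP eqP setIidPr) SV andbF.
  by move=> S; rewrite inE => /andP[SV _]; rewrite setDDr setDv set0U (setIidPr SV).
have E : q`!%:R * \sum_(S in level K.+1) \sum_(U in level K.+1 | [disjoint S & U]) f S * g U
   = dot K.+1 (iter q down h) g.
  rewrite (exchange_big_dep (mem (level K.+1))) /=; last by move=> ? ? _ /andP[].
  rewrite mulr_sumr; apply: eq_bigr => U lU; rewrite -mulr_suml mulrA; congr (_ * _).
  have := lU; rewrite inE => /andP[UV /eqP cU].
  rewrite iter_downE // cU; congr (_ * _).
  rewrite [RHS]big_mkcondr /=.
  pose F S := if U \subset V :\: S then f S else 0.
  transitivity (\sum_(S in level (K.+1 + q)) F (V :\: S)).
    rewrite lev big_mkcond /= [RHS]big_mkcond; apply: eq_bigr => S _.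
    rewrite !inE UV eqxx /F subsetD UV /= disjoint_sym.
    by case: (S \subset V); case: (#|S| == _).
  apply: eq_bigr => S; rewrite inE => /andP[SV _].
  by rewrite /F setDDr setDv set0U (setIidPr SV).
have qp : (0 : R) < q`!%:R ^+ 2 by rewrite exprn_gt0 // ltr0n fact_gt0.
rewrite -(ler_pM2l qp) -exprMn E.
apply: le_trans (cauchy_schwarz _ _ _) _.
rewrite [X in _ <= X]mulrA ler_wpM2r ?dot_ge0 //.
apply: le_trans (iter_down_contract _ _) _.
- by rewrite Vq leq_add2r leq_addr.
- by rewrite lev.
rewrite (prod_contract Vq) natrX natrM exprMn -mulrA.
by rewrite /dot (lev (fun S => f S * f S)).
Qed.

End Spectral.

(** * The expander mixing lemma for Kneser graphs *)

Section Mixing.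
Variable R : realFieldType.

(** The indicator of P minus its mean sums to zero, so [kneser_bound] applies to it. The mean
    contributes exactly the main term, because the Kneser graph is regular. *)
Lemma disjoint_pairs (T : finType) (V : {set T}) (K : nat) (P Q : {set {set T}}) :
  (0 < K)%N -> (K + K <= #|V|)%N -> P \subset level V K -> Q \subset level V K ->
  ('C(#|V| - K, K)%:R / 'C(#|V|, K)%:R * #|P|%:R * #|Q|%:R
     - (\sum_(S in P) #|[set U in Q | [disjoint S & U]]|)%:R) ^+ 2
  <= 'C(#|V| - K.+1, K.-1)%:R ^+ 2 * #|P|%:R * #|Q|%:R :> R.
Proof.
move=> K0 KV PV QV.
have cl : #|level V K| = 'C(#|V|, K) by rewrite cards_draws.
set N := 'C(#|V|, K) in cl *.
have N0 : N%:R != 0 :> R by rewrite pnatr_eq0 -lt0n bin_gt0; lia.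
pose g (Z : {set {set T}}) S : R := (S \in Z)%:R.
pose f S : R := g P S - #|P|%:R / N%:R.
have sumg (Z : {set {set T}}) (h : {set T} -> R) : Z \subset level V K ->
    \sum_(S in level V K) g Z S * h S = \sum_(S in Z) h S.
  move=> ZV; rewrite (big_setID Z) /= (setIidPr ZV) [X in _ + X]big1 ?addr0.
    by apply: eq_bigr => S SZ; rewrite /g SZ mul1r.
  by move=> S; rewrite inE => /andP[/negbTE SZ _]; rewrite /g SZ mul0r.
have sumg1 (Z : {set {set T}}) : Z \subset level V K -> \sum_(S in level V K) g Z S = #|Z|%:R.
  move=> ZV; rewrite -sum1_card natr_sum -(sumg Z (fun=> 1%:R)) //.
  by apply: eq_bigr => S _; rewrite mulr1.
have f0 : \sum_(S in level V K) f S = 0.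
  by rewrite sumrB sumg1 // sumr_const cl -[_ *+ N]mulr_natr divfK ?subrr.
have gg : dot V K (g Q) (g Q) = #|Q|%:R.
  rewrite /dot sumg // -sumg1 // [RHS](big_setID Q) /= (setIidPr QV).
  rewrite [X in _ + X]big1 ?addr0 // => S; rewrite inE => /andP[/negbTE SQ _].
  by rewrite /g SQ.
(* As f sums to zero, <f, f> is the sum of f over P, where f <= 1. *)
have ff : dot V K f f <= #|P|%:R.
  have -> : dot V K f f = \sum_(S in level V K) g P S * f S
       - #|P|%:R / N%:R * \sum_(S in level V K) f S.
    by rewrite mulr_sumr -sumrB; apply: eq_bigr => S _; rewrite /f; ring.
  rewrite f0 mulr0 subr0 sumg // -[X in _ <= X%:R]sum1_card natr_sum.
  apply: ler_sum => S SP; rewrite /f /g SP lerBlDr lerDl.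
  by rewrite divr_ge0.
have Delta U : U \in level V K ->
    #|[set S in level V K | [disjoint S & U]]| = 'C(#|V| - K, K).
  rewrite inE => /andP[UV /eqP cU].
  have <- : #|V :\: U| = (#|V| - K)%N by rewrite cardsD (setIidPr UV) cU.
  rewrite -cards_draws; apply: eq_card => S; rewrite !inE subsetD.
  by case: (S \subset V) => //=; rewrite andbC.
have E : \sum_(S in level V K) \sum_(U in level V K | [disjoint S & U]) f S * g Q U =
   (\sum_(S in P) #|[set U in Q | [disjoint S & U]]|)%:R
   - 'C(#|V| - K, K)%:R / N%:R * #|P|%:R * #|Q|%:R.
  have -> : \sum_(S in level V K) \sum_(U in level V K | [disjoint S & U]) f S * g Q U =
    \sum_(S in level V K) g P S * (\sum_(U in level V K | [disjoint S & U]) g Q U)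
    - #|P|%:R / N%:R * \sum_(S in level V K) \sum_(U in level V K | [disjoint S & U]) g Q U.
    rewrite mulr_sumr -sumrB; apply: eq_bigr => S _; rewrite -mulrBl mulr_sumr.
    by apply: eq_bigr => U _.
  congr (_ - _).
    rewrite sumg // natr_sum; apply: eq_bigr => S SP.
    rewrite -sum1_card natr_sum big_mkcondr /=.
    rewrite (eq_bigr (fun U => g Q U * (if [disjoint S & U] then 1 else 0))); last first.
      by move=> U _; case: ifP; rewrite ?mulr1 ?mulr0.
    by rewrite sumg // -big_mkcondr; apply: eq_bigl => U; rewrite inE.
  rewrite (exchange_big_dep (fun U => U \in level V K)) /=; last by move=> ? ? _ /andP[].
  rewrite (eq_bigr (fun U => g Q U * 'C(#|V| - K, K)%:R)); last first.
    move=> U UV; rewrite sumr_const -(Delta U UV) mulr_natr; congr (_ *+ _).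
    by apply: eq_card => S; rewrite unfold_in [RHS]in_set UV.
  by rewrite sumg // sumr_const -[_ *+ #|Q|]mulr_natr; field.
rewrite -sqrrN opprB -E -gg.
apply: le_trans (kneser_bound _ K0 KV f0) _.
rewrite ler_wpM2r ?dot_ge0 // ler_wpM2l ?exprn_ge0 //.
Qed.

(** Take b <= a and s = (a - b) / 2. If D were smaller, e <= D b would give rho a b - e > b (rho s +
    lam). The square of the right side is already at least lam^2 a b because lam <= rho b. *)
Lemma mixing_arith (a b rho lam e D : R) : 0 < a -> 0 < b -> 0 <= lam -> 0 <= rho ->
  lam <= rho * a -> lam <= rho * b ->
  (rho * a * b - e) ^+ 2 <= lam ^+ 2 * a * b -> e <= D * a -> e <= D * b ->
  rho * ((a + b) / 2) - lam <= D.
Proof.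
wlog ba : a b / b <= a => [W|].
  case: (leP b a) => [/W //|/ltW /W W' *].
  by rewrite [a + b]addrC; apply: W' => //; rewrite -![_ * b * a]mulrA [b * a]mulrC !mulrA.
move=> a0 b0 l0 r0 la lb h _ eb; rewrite leNgt; apply/negP => Dlt.
pose s := (a - b) / 2.
have s0 : 0 <= s by rewrite divr_ge0 ?subr_ge0.
have aE : a = b + 2 * s by rewrite /s; field.
have Y0 : 0 <= rho * s + lam by rewrite addr_ge0 // mulr_ge0.
have XY : b * (rho * s + lam) < rho * a * b - e.
  apply: lt_le_trans (_ : rho * a * b - D * b <= _); last by rewrite lerD2l lerN2.
  have -> : rho * a * b - D * b = b * (rho * a - D) by ring.
  rewrite ltr_pM2l //.
  have -> : rho * s + lam = rho * a - (rho * ((a + b) / 2) - lam) by rewrite /s; field.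
  by rewrite ltrD2l ltrN2.
have bY0 : 0 <= b * (rho * s + lam) by rewrite mulr_ge0 // ltW.
have : (b * (rho * s + lam)) ^+ 2 < (rho * a * b - e) ^+ 2.
  by rewrite ltr_pXn2r // ?nnegrE // ltW // (le_lt_trans bY0).
move=> /lt_le_trans/(_ h); rewrite ltNge => /negP; apply.
rewrite -subr_ge0.
have -> : (b * (rho * s + lam)) ^+ 2 - lam ^+ 2 * a * b =
    b * (b * (rho * s) ^+ 2 + 2 * (s * lam * (rho * b - lam))).
  by rewrite aE; ring.
have b0' := ltW b0; apply: mulr_ge0 => //; apply: addr_ge0.
  by apply: mulr_ge0 => //; apply: sqr_ge0.
apply: mulr_ge0 => //; apply: mulr_ge0; first exact: mulr_ge0.
by rewrite subr_ge0.
Qed.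

End Mixing.

(** * Comparison of the two lower bounds, and the size of the family *)

(** With rho = D / N, the claim follows from rho >= 1 - k^2 / n and rho c <= c'; the latter turns
    the loss rho c / 2 + c' into 3 c' / 2. *)
Lemma second_bound (R : realFieldType) (n k : nat) (m : R) :
  (3 <= k)%N -> (64 * k ^ 2 <= n)%N -> 0 <= m ->
  1 / 2 * (1 - k%:R ^+ 2 / n%:R) * m - 3 / 2 * 'C(n - k - 2, k - 2)%:R
  <= ((m - 'C(n - 2, k - 2)%:R) / 2 * 'C(n - k - 1, k - 1)%:R) / 'C(n - 2, k - 1)%:R
      - 'C(n - k - 2, k - 2)%:R.
Proof.
move=> k3 nk m0; rewrite -mulnn in nk.
have n_k : (4 * k + 2 <= n)%N by move: nk k3; clear; nia.
have n0 : 0 < n%:R :> R by rewrite ltr0n; nia.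
have N0 : 0 < 'C(n - 2, k - 1)%:R :> R by rewrite ltr0n bin_gt0; nia.
set N : R := 'C(n - 2, k - 1)%:R in N0 *; set D : R := 'C(n - k - 1, k - 1)%:R.
set c : R := 'C(n - 2, k - 2)%:R; set c' : R := 'C(n - k - 2, k - 2)%:R.
have rho_ge : 1 - k%:R ^+ 2 / n%:R <= D / N.
  have := bin_ratio (n - k - 1) (k - 1) (k - 1).
  have -> : (n - k - 1 + (k - 1) = n - 2)%N by lia.
  rewrite -(ler_nat R) natrD !natrM -/N -/D => h.
  have n2 : 0 < (n - 2)%:R :> R by rewrite ltr0n; nia.
  apply: (@le_trans _ _ (1 - ((k - 1) * (k - 1))%:R / (n - 2)%:R)).
    rewrite lerD2l lerN2 -natrX ler_pdivrMr // mulrAC ler_pdivlMr // -!natrM ler_nat.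
    by rewrite -mulnn; nia.
  rewrite ler_pdivlMr // mulrBl mul1r lerBlDr -(ler_pM2l n2) natrM.
  apply: le_trans h _; rewrite le_eqVlt; apply/orP; left; apply/eqP.
  by field; rewrite gt_eqF.
(* Since N / c = (n - k) / (k - 1) and D / c' = (n - k - 1) / (k - 1), the quotient of the two sides
   is (n - k - 1) / (n - k). *)
have rho_c : D / N * c <= c'.
  have e1 := mul_bin_left (n - 2) (k - 2).
  have e2 := mul_bin_diag (n - k - 1) (k - 2).
  have ek : ((k - 2).+1 = k - 1)%N by lia.
  have en : ((n - k - 1).-1 = n - k - 2)%N by lia.
  have en2 : (n - 2 - (k - 2) = n - k)%N by lia.
  rewrite ek en2 in e1; rewrite ek en in e2.
  have : ('C(n - k - 1, k - 1) * 'C(n - 2, k - 2) <=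
         'C(n - k - 2, k - 2) * 'C(n - 2, k - 1))%N.
    have k1 : (0 < (k - 1) * (n - k))%N by rewrite muln_gt0; nia.
    rewrite -(leq_pmul2l k1).
    apply: (@leq_trans ((k - 1) * 'C(n - k - 1, k - 1) * ((n - k) * 'C(n - 2, k - 2)))).
      by rewrite mulnACA.
    rewrite -e1 -e2 [X in (X <= _)%N]mulnACA [((k - 1) * (n - k))%N]mulnC.
    by apply: leq_mul => //; apply: leq_mul => //; lia.
  rewrite -(ler_nat R) !natrM -/N -/D -/c -/c' => h.
  by rewrite mulrAC ler_pdivrMr.
have -> : (m - c) / 2 * D / N = (D / N * m - D / N * c) / 2.
  by field; rewrite gt_eqF.
have := ler_wpM2r m0 rho_ge; lra.
Qed.

(** As n >= 64 k^2, [bin_ratio] loses at most half. The difference of binomials is at least k C(n -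
    k - 1, k - 2) >= k c / 2 with c = C(n - 2, k - 2), and four times this is 2 k c. *)
Lemma binomial_mass (n k m : nat) : (3 <= k)%N -> (64 * k ^ 2 <= n)%N ->
  (4 * ('C(n - 1, k - 1) - 'C(n - k - 1, k - 1) + 2) <= m)%N ->
  [/\ 'C(n - 2, k - 2) <= 2 * 'C(n - k - 2, k - 2),
      'C(n - 2, k - 1) <= 2 * 'C(n - k - 1, k - 1) &
      2 * k * 'C(n - 2, k - 2) <= m]%N.
Proof.
move=> k3; rewrite -mulnn => nk hm.
have n_k : (4 * k + 2 <= n)%N by move: nk k3; clear; nia.
have h1 : ('C(n - 2, k - 2) <= 2 * 'C(n - k - 2, k - 2))%N.
  have := bin_ratio (n - k - 2) k (k - 2).
  have -> : (n - k - 2 + k = n - 2)%N by lia.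
  move: 'C(_, _) 'C(_, _) => x y h.
  have : (2 * (k * (k - 2)) <= n - 2)%N by nia.
  have : (0 < n - 2)%N by nia.
  by move: h; move: (n - 2)%N (k * (k - 2))%N => N q; clear; nia.
split=> //.
  have := bin_ratio (n - k - 1) (k - 1) (k - 1).
  have -> : (n - k - 1 + (k - 1) = n - 2)%N by lia.
  move: 'C(_, _) 'C(_, _) => x y h.
  have : (2 * ((k - 1) * (k - 1)) <= n - 2)%N by nia.
  have : (0 < n - 2)%N by nia.
  by move: h; move: (n - 2)%N ((k - 1) * (k - 1))%N => N q; clear; nia.
have := leq_bin_add k (n - k - 1) (k - 2).
have -> : ((k - 2).+1 = k - 1)%N by lia.
have -> : (n - k - 1 + k = n - 1)%N by lia.
have : ('C(n - k - 2, k - 2) <= 'C(n - k - 1, k - 2))%N by apply: leq_bin2l; lia.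
rewrite -(leq_pmul2l (_ : 0 < k)%N); last by lia.
move: h1; rewrite -(leq_pmul2l (_ : 0 < k)%N); last by lia.
by lia.
Qed.

(** * Two stars as a bipartite Kneser graph *)

Section TwoStars.
Variables (T : finType) (F : {set {set T}}) (k : nat).
Implicit Types (A B S U : {set T}) (x y : T).
Hypothesis Fk : forall A, A \in F -> #|A| = k.

(** The members through x but not y, with x removed, so that both sides are families of (k - 1)-sets
    on the same ground set. *)
Definition side x y : {set {set T}} :=
  [set S in level (~: [set x; y]) (k - 1) | x |: S \in F].

Lemma card_side x y : x != y ->
  #|side x y| = #|[set A in F | (x \in A) && (y \notin A)]|.
Proof.
move=> xy; rewrite -[LHS](card_in_imset (f := fun S => x |: S)); last first.
  move=> S U; rewrite !inE => /andP[/andP[sS _] _] /andP[/andP[sU _] _] E.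
  have xS (Z : {set T}) : Z \subset ~: [set x; y] -> (x |: Z) :\ x = Z.
    move=> sZ; apply: setU1K; apply/negP => /(subsetP sZ).
    by rewrite !inE eqxx.
  by rewrite -(xS S) // E xS.
apply: eq_card => A; apply/imsetP/idP.
  case=> S; rewrite !inE => /andP[/andP[sS _] SF] ->.
  rewrite !inE SF eqxx negb_or eq_sym xy /=; apply/negP => /(subsetP sS).
  by rewrite !inE eqxx orbT.
rewrite !inE => /and3P[AF xA yA]; exists (A :\ x); last by rewrite setD1K.
rewrite !inE setD1K // AF andbT; apply/andP; split.
  apply/subsetP => z; rewrite !inE => /andP[zx zA]; rewrite negb_or zx /=.
  by apply: contraNneq yA => <-.
by have := Fk AF; rewrite (cardsD1 x) xA => <-; rewrite add1n subn1.
Qed.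

Lemma side_degree x y S : x != y -> S \in side x y ->
  (#|[set U in side y x | [disjoint S & U]]|
     <= #|[set B in F | B :&: (x |: S) == set0]|)%N.
Proof.
move=> xy; rewrite !inE => /andP[/andP[sS _] _].
rewrite -[X in (X <= _)%N](card_in_imset (f := fun U => y |: U)); last first.
  move=> U W; rewrite !inE => /andP[/andP[/andP[sU _] _] _] /andP[/andP[/andP[sW _] _] _] E.
  have yZ (Z : {set T}) : Z \subset ~: [set y; x] -> (y |: Z) :\ y = Z.
    move=> sZ; apply: setU1K; apply/negP => /(subsetP sZ).
    by rewrite !inE eqxx.
  by rewrite -(yZ U) // E yZ.
apply/subset_leq_card/subsetP => B /imsetP[U].
rewrite !inE => /andP[/andP[/andP[sU _] yF] dSU] ->; rewrite yF /=.
apply/eqP/setP => z; rewrite !inE; apply/negP => /andP[/orP[/eqP->|zU] /orP[/eqP zx|zS]].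
- by rewrite zx eqxx in xy.
- by have := subsetP sS _ zS; rewrite !inE eqxx orbT.
- by have := subsetP sU _ zU; rewrite !inE zx eqxx orbT.
- by have := disjointFr dSU zS; rewrite zU.
Qed.

(** With a and b the sizes of the sides, |F| <= a + b + c, and the [e] disjoint pairs across number
    at most D a and D b. As a >= deg x - c and b >= deg y - c, the degree hypotheses supply what
    [mixing_arith] asks of a and b. *)
Lemma two_stars_bound (R : realFieldType) x y (D : nat) :
  x != y -> (1 < k)%N -> (2 * k <= #|T|)%N ->
  (forall A, A \in F -> (x \in A) || (y \in A)) ->
  (forall A, A \in F -> (#|[set B in F | B :&: A == set0]| <= D)%N) ->
  let c := 'C(#|T| - 2, k - 2) in
  let rho : R := 'C(#|T| - k - 1, k - 1)%:R / 'C(#|T| - 2, k - 1)%:R in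
  let lam : R := 'C(#|T| - k - 2, k - 2)%:R in
  (c < deg F x)%N -> (c < deg F y)%N ->
  lam <= rho * (deg F x - c)%:R -> lam <= rho * (deg F y - c)%:R ->
  rho * ((#|F|%:R - c%:R) / 2) - lam <= D%:R.
Proof.
move=> xy k1 kn cov dis c rho lam cx cy lx ly.
have rho0 : 0 <= rho by rewrite divr_ge0.
pose a := #|side x y|; pose b := #|side y x|.
have c_xy : (codeg F x y <= c)%N by apply: codeg_leq.
have deg_a u v : u != v -> (deg F u <= #|side u v| + codeg F u v)%N.
  move=> uv; rewrite card_side // /deg.
  rewrite -[X in (X <= _)%N](cardsID [set A : {set T} | v \in A]) addnC.
  apply: leq_add; apply/subset_leq_card/subsetP => A; rewrite !inE.
    by case/andP=> -> /andP[-> ->].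
  by case/andP=> /andP[-> ->] ->.
have yx : y != x by rewrite eq_sym.
have c_yx : (codeg F y x <= c)%N by apply: codeg_leq.
have da := deg_a x y xy; have db := deg_a y x yx.
have total : (#|F| <= a + b + c)%N.
  have : (#|F| <= a + b + codeg F x y)%N; last by lia.
  rewrite /a /b !card_side // /codeg.
  apply: leq_trans (leq_add (leq_card_setU _ _).1 (leqnn _)).
  apply: leq_trans (leq_card_setU _ _).1.
  apply/subset_leq_card/subsetP => A AF; have := cov A AF; rewrite !inE AF /=.
  by case: (x \in A); case: (y \in A).
have cV : #|~: [set x; y]| = (#|T| - 2)%N by rewrite cardsCs setCK cards2 xy.
have Vyx : ~: [set y; x] = ~: [set x; y] by rewrite setUC.
have := @disjoint_pairs R T (~: [set x; y]) (k - 1) (side x y) (side y x).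
have -> : ((k - 1).+1 = k)%N by lia.
rewrite cV -/a -/b.
have -> : (#|T| - 2 - (k - 1) = #|T| - k - 1)%N by lia.
have -> : (#|T| - 2 - k = #|T| - k - 2)%N by lia.
have -> : ((k - 1).-1 = k - 2)%N by lia.
rewrite -/rho -/lam; set e := (\sum_(S in _) _)%N.
have subV u v : side u v \subset level (~: [set u; v]) (k - 1).
  by apply/subsetP => S; rewrite inE => /andP[].
have k1' : (0 < k - 1)%N by lia.
have kk : (k - 1 + (k - 1) <= #|T| - 2)%N by lia.
have sQ := subV y x; rewrite Vyx in sQ.
move=> /(_ k1' kk (subV x y) sQ) spec.
have inF u v S : S \in side u v -> u |: S \in F by rewrite inE => /andP[].
have ea : (e <= D * a)%N.
  rewrite mulnC -sum_nat_const; apply: leq_sum => S SP.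
  by apply: leq_trans (side_degree xy SP) (dis _ (inF _ _ _ SP)).
(* The same pairs, counted from the other side. *)
have eb : (e <= D * b)%N.
  have -> : e = (\sum_(U in side y x) #|[set S in side x y | [disjoint U & S]]|)%N.
    rewrite /e; under eq_bigr => S _ do rewrite -sum1dep_card.
    under [RHS]eq_bigr => S _ do rewrite -sum1dep_card.
    rewrite (exchange_big_dep (mem (side y x))) /=; last by move=> ? ? _ /andP[].
    apply: eq_bigr => U UQ; apply: eq_bigl => S.
    by rewrite UQ /= disjoint_sym.
  rewrite mulnC -sum_nat_const; apply: leq_sum => S SP.
  by apply: leq_trans (side_degree yx SP) (dis _ (inF _ _ _ SP)).
have la : lam <= rho * a%:R.
  by apply: le_trans lx _; apply: ler_wpM2l => //; rewrite ler_nat; lia.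
have lb : lam <= rho * b%:R.
  by apply: le_trans ly _; apply: ler_wpM2l => //; rewrite ler_nat; lia.
apply: le_trans (@mixing_arith R a%:R b%:R rho lam e%:R D%:R _ _ _ rho0 la lb spec _ _).
- rewrite lerD2r; apply: ler_wpM2l => //; rewrite ler_pM2r ?invr_gt0 //.
  by rewrite lerBlDr -!natrD ler_nat.
- rewrite ltr0n -(ltn_add2r c) add0n.
  by apply: leq_trans cx (leq_trans da _); rewrite leq_add2l.
- rewrite ltr0n -(ltn_add2r c) add0n.
  by apply: leq_trans cy (leq_trans db _); rewrite leq_add2l.
- by [].
- by rewrite -natrM ler_nat.
- by rewrite -natrM ler_nat.
Qed.

End TwoStars.

(** * Deduction of the two inequalities *)

Theorem theorem6 :
  exists k0 : nat, forall (k n : nat), (k0 <= k)%N -> (64 * k ^ 2 <= n)%N ->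
  forall F : {set {set 'I_n}},
    F \subset ksubsets n k ->
    ~~ intersecting F ->
    4 * ('C(n - 1, k - 1)%:R - 'C(n - k - 1, k - 1)%:R + 2) <= #|F|%:R :> rat ->
    dfam F = dmin #|F| n k ->
    (dfam F)%:R
      >= ((#|F|%:R - 'C(n - 2, k - 2)%:R) / 2 * 'C(n - k - 1, k - 1)%:R)
           / 'C(n - 2, k - 1)%:R
         - 'C(n - k - 2, k - 2)%:R :> rat
    /\
    ((#|F|%:R - 'C(n - 2, k - 2)%:R) / 2 * 'C(n - k - 1, k - 1)%:R)
        / 'C(n - 2, k - 1)%:R
      - 'C(n - k - 2, k - 2)%:R
      >= 1 / 2 * (1 - k%:R ^+ 2 / n%:R) * #|F|%:R
         - 3 / 2 * 'C(n - k - 2, k - 2)%:R :> rat.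
Proof.
have [k0 scale] := log_scale; exists k0 => k n /scale[j [j1 kj jk]] nk F sF nF mF _.
have k3 : (1000 <= k)%N by move: jk j1; rewrite -mulnn; clear; nia.
have k3' : (3 <= k)%N by lia.
split; last by apply: second_bound.
have n_k : (4 * k + 2 <= n)%N by move: nk k3; rewrite -mulnn; clear; nia.
have Fk A : A \in F -> #|A| = k by move/(subsetP sF); rewrite inE => /eqP.
have mh : (4 * ('C(n - 1, k - 1) - 'C(n - k - 1, k - 1) + 2) <= #|F|)%N.
  rewrite -(ler_nat rat) natrM natrD natrB //.
  by apply: leq_bin2l; lia.
have [cc NN mc] := binomial_mass k3' nk mh.
have dis A : A \in F -> (#|[set B in F | B :&: A == set0]| <= dfam F)%N.
  by move=> AF; rewrite /dfam; apply: (@leq_bigmax_cond _ (mem F)).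
have c0 : (0 < 'C(n - 2, k - 2))%N by rewrite bin_gt0; lia.
have N0 : (0 < 'C(n - 2, k - 1))%N by rewrite bin_gt0; lia.
have ND : ('C(n - k - 1, k - 1) <= 'C(n - 2, k - 1))%N by apply: leq_bin2l; lia.
have m1 : (1000 * 'C(n - 2, k - 2) <= #|F|)%N.
  by apply: leq_trans mc; rewrite leq_mul2r; apply/orP; right; lia.
rewrite leNgt; apply/negP => small.
have sumE : ((#|F|%:R - 'C(n - 2, k - 2)%:R) / 2 * 'C(n - k - 1, k - 1)%:R)
    / 'C(n - 2, k - 1)%:R = 'C(n - k - 1, k - 1)%:R / 'C(n - 2, k - 1)%:R
     * ((#|F|%:R - 'C(n - 2, k - 2)%:R) / 2) :> rat by rewrite -mulrA mulrC.
rewrite sumE in small.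
set rho : rat := 'C(n - k - 1, k - 1)%:R / 'C(n - 2, k - 1)%:R in small.
have rho1 : rho <= 1 by rewrite ler_pdivrMr ?ltr0n // mul1r ler_nat.
have rho2 : 1 / 2 <= rho.
  rewrite ler_pdivlMr ?ltr0n // mulrC mulrA mulr1 ler_pdivrMr // -natrM ler_nat.
  by rewrite mulnC.
(* As rho <= 1, failure of the bound already forces 2 d(F) + c < |F|. *)
have few : forall A, A \in F ->
    (2 * #|[set B in F | B :&: A == set0%SET]| + 'C(n - 2, k - 2) < #|F|)%N.
  move=> A AF; suff : (2 * dfam F + 'C(n - 2, k - 2) < #|F|)%N.
    by have := dis A AF; lia.
  rewrite -(ltr_nat rat) natrD natrM.
  have : rho * ((#|F|%:R - 'C(n - 2, k - 2)%:R) / 2) <=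
      1 * ((#|F|%:R - 'C(n - 2, k - 2)%:R) / 2).
    apply: ler_wpM2r => //; rewrite divr_ge0 // subr_ge0 ler_nat.
    by move: m1; move: 'C(_, _) => q; clear; lia.
  move: cc small; rewrite -(ler_nat rat) natrM.
  have : 0 < 'C(n - 2, k - 2)%:R :> rat by rewrite ltr0n.
  move: (rho * _) => q *; lra.
have := @two_centers 'I_n F j k Fk j1 kj jk; rewrite card_ord.
move=> /(_ nk mc mh few); case.
  move: nF; rewrite negb_forall => /existsP[A].
  rewrite negb_imply negb_forall => /andP[AF /existsP[B]].
  by rewrite negb_imply negbK => /andP[BF /eqP AB]; exists A, B.
move=> x [y [xy dx dy cov]].
have := @two_stars_bound 'I_n F k Fk rat x y (dfam F) xy.
rewrite card_ord => /(_ _ _ cov dis) bnd.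
(* A centre has degree at least 3 |F| / 8 >= 3 c, and rho >= 1 / 2, so rho (deg z - c) >= c, which
   is at least the eigenvalue. *)
have lam_le z : (3 * #|F| <= 8 * deg F z)%N ->
    'C(n - k - 2, k - 2)%:R <= rho * (deg F z - 'C(n - 2, k - 2))%:R.
  move=> dz; have : (2 * 'C(n - 2, k - 2) <= deg F z - 'C(n - 2, k - 2))%N.
    by move: dz m1; move: 'C(_, _) (deg _ _) #|F| => p q r; clear; lia.
  rewrite -(ler_nat rat) natrM => h.
  apply: le_trans (_ : 1 / 2 * (deg F z - 'C(n - 2, k - 2))%:R <= _).
    apply: le_trans (_ : 'C(n - 2, k - 2)%:R <= _); last first.
      by rewrite mul1r ler_pdivlMl.
    by rewrite ler_nat; apply: leq_bin2l; rewrite leq_sub2r // leq_subr.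
  exact: ler_wpM2r.
have deg_gt z : (3 * #|F| <= 8 * deg F z)%N -> ('C(n - 2, k - 2) < deg F z)%N.
  by move: m1 c0; move: 'C(_, _) (deg _ _) #|F| => p q r; clear; lia.
move: small; rewrite ltNge => /negP; apply; apply: bnd.
- by lia.
- by lia.
- exact: deg_gt.
- exact: deg_gt.
- exact: lam_le.
- exact: lam_le.
Qed.
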